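(* The following hold. (a) Let $\tau$ be an infinite cardinal, let $Y$ be a Banach space with $w(Y)\leq\tau$, and let $0\leq\alpha<1$. Whenever $X$ is a $\tau$-PF-normal space, every mapping $\varphi:X\to\mathscr{F}_{\alpha}(Y)$ having the Dense Multi-selection Property (DMP) has a continuous selection, i.e. there is a continuous $f:X\to Y$ with $f(x)\in\varphi(x)$ for every $x\in X$. (b) For every $0\leq\alpha<1$ there exists $\delta=\delta(\alpha)>0$, depending only on $\alpha$, such that: if $\tau$ is an infinite cardinal, $Y$ is a Banach space with $w(Y)\leq\tau$, $X$ is a $\tau$-PF-normal space, $\varphi:X\to\mathscr{F}_{\alpha}(Y)$ has the DMP, and $g:X\to Y$ is a continuous $r$-selection for $\varphi$ for some $r>0$, then $\varphi$ has a continuous selection $f:X\to Y$ with $d(g(x),f(x))<\delta r$ for all $x\in X$.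
   Context: Notation: $w(Y)$ is the topological weight of $Y$. For a normed space $Y$, $d$ is the metric on $Y$ generated by the norm. In a metric space, $d(p,P)=\inf_{q\in P}d(p,q)$ and $B_r(x)=\{y\in Y: d(x,y)<r\}$. $2^Y$ is the family of all non-empty subsets of $Y$; $\mathscr{F}(Y)=\{S\in 2^Y: S \text{ is closed}\}$; $\mathscr{C}(Y)=\{S\in\mathscr{F}(Y): S\text{ is compact}\}$. $\operatorname{conv}(A)$ is the convex hull of $A$. Paraconvexity: for $0\leq\alpha\leq 1$, a subset $P$ of a normed space $Y$ is $\alpha$-paraconvex if whenever $r>0$ and $d(p,P)<r$ for some $p\in Y$, then $d(q,P)\leq\alpha r$ for all $q\in\operatorname{conv}(B_r(p)\cap P)$. $\mathscr{F}_{\alpha}(Y)$ is the set of all $\alpha$-paraconvex members of $\mathscr{F}(Y)$. Set-valued mappings: $\varphi:X\to 2^Y$ is lower semi-continuous (l.s.c.) if $\varphi^{-1}(U)=\{x\in X:\varphi(x)\cap U\neq\emptyset\}$ is open in $X$ for every open $U\subset Y$. A mapping $\psi:X\to 2^Y$ is a multi-selection for $\varphi:X\to 2^Y$ if $\psi(x)\subset\varphi(x)$ for every $x\in X$. A single-valued mapping $g:X\to Y$ to a metric space $(Y,d)$ is an $\varepsilon$-selection ($\varepsilon>0$) for $\varphi:X\to 2^Y$ if $d(g(x),\varphi(x))<\varepsilon$ for every $x\in X$. DMP: for a metric space $(Y,d)$, a mapping $\varphi:X\to 2^Y$ has the Dense Multi-selection Property (DMP) if (i) $\varphi$ has an l.s.c.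 multi-selection $\psi:X\to\mathscr{C}(Y)$; and (ii) for every $\varepsilon>0$, every cozero-set $U\subset X$, and every continuous $\varepsilon$-selection $g:U\to Y$ for the restriction $\varphi|_U$, there exists an l.s.c. $\psi:U\to\mathscr{C}(Y)$ such that $\psi(x)\subset\overline{\varphi(x)\cap B_{\varepsilon}(g(x))}$ for all $x\in U$. $\tau$-PF-normality: the star of $A\subset X$ with respect to a cover $\mathscr{U}$ of $X$ is $\operatorname{St}(A,\mathscr{U})=\bigcup\{U\in\mathscr{U}:A\cap U\neq\emptyset\}$. A cover $\mathscr{U}$ is a star-refinement of a cover $\mathscr{V}$ if for each $U\in\mathscr{U}$ there is $V\in\mathscr{V}$ with $\operatorname{St}(U,\mathscr{U})\subset V$. A normal sequence is a sequence $\{\mathscr{U}_n:n\in\mathbb{N}\}$ of open covers of $X$ such that $\mathscr{U}_{n+1}$ is a star-refinement of $\mathscr{U}_n$ for each $n$. An open cover $\mathscr{U}$ is normal if $\mathscr{U}=\mathscr{U}_1$ for some normal sequence $\{\mathscr{U}_n:n\in\mathbb{N}\}$ of open covers of $X$. A $T_1$-space $X$ is $\tau$-PF-normal if every point-finite open cover $\mathscr{U}$ of $X$ with $|\mathscr{U}|\leq\tau$ is normal. *)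

(* Defs.v *)
From HB Require Import structures.
From mathcomp Require Import all_boot all_order all_algebra.
From mathcomp Require Import all_classical all_reals all_analysis.
Set Implicit Arguments.
Unset Strict Implicit.
Unset Printing Implicit Defensive.
Import Order.TTheory GRing.Theory Num.Theory.
Import numFieldNormedType.Exports.
Local Open Scope classical_set_scope.
Local Open Scope ring_scope.
Local Open Scope card_scope.

(* A cardinal [tau] is represented by a type of that cardinality, and a
   statement "the cardinality of A is at most tau" by [A #<= [set: tau]].
   The weight is the least cardinality of a base, so it is at most [tau] iff
   some base has cardinality at most [tau]. *)
Definition weight_le (Y : topologicalType) (tau : Type) : Prop :=
  exists2 B : set (set Y), basis B & B #<= [set: tau].

Section Covers.
Context {X : topologicalType}.
Implicit Types (A : set X) (U V : set (set X)).

Definition open_cover U : Prop :=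
  (forall A, U A -> open A) /\ \bigcup_(A in U) A = [set: X].

Definition point_finite U : Prop :=
  forall x : X, finite_set [set A | U A /\ A x].

Definition star A U : set X :=
  \bigcup_(B in [set B | U B /\ A `&` B !=set0]) B.

Definition star_refines U V : Prop :=
  forall A, U A -> exists2 B, V B & star A U `<=` B.

Definition normal_sequence (W : nat -> set (set X)) : Prop :=
  (forall n, open_cover (W n)) /\ (forall n, star_refines (W n.+1) (W n)).

(* The terms of a normal sequence are numbered from 0. *)
Definition normal_cover U : Prop :=
  exists2 W : nat -> set (set X), normal_sequence W & U = W 0%N.

End Covers.

Definition PF_normal (tau : Type) (X : topologicalType) : Prop :=
  accessible_space X /\
  forall U : set (set X), open_cover U -> point_finite U ->
    U #<= [set: tau] -> normal_cover U.

Definition cozero_set (R : realType) (X : topologicalType) (U : set X) : Prop :=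
  exists2 h : X -> R, continuous h & U = [set x | h x != 0].

Definition lsc (X Y : topologicalType) (phi : X -> set Y) : Prop :=
  forall V : set Y, open V -> open [set x | phi x `&` V !=set0].

Definition multi_selection (X Y : Type) (psi phi : X -> set Y) : Prop :=
  forall x, psi x `<=` phi x.

Definition nonempty_closed (Y : topologicalType) (S : set Y) : Prop :=
  S !=set0 /\ closed S.

Definition nonempty_compact (Y : topologicalType) (S : set Y) : Prop :=
  nonempty_closed S /\ compact S.

Section NormedSpace.
Context {R : realType} {Y : normedModType R}.
Implicit Types (p q : Y) (P : set Y).

(* [inf] is only meaningful on nonempty sets; every use below has [P]
   nonempty, except in [paraconvex], which holds vacuously for [set0]. *)
Definition dist_set p P : R := inf [set `|p - q| | q in P].

Definition convex_hull P : set Y :=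
  smallest (fun C : set Y => convex_set (C : set (convex_lmodType Y))) P.

Definition paraconvex (alpha : R) P : Prop :=
  forall (r : R) p, 0 < r -> dist_set p P < r ->
    forall q, convex_hull (ball p r `&` P) q -> dist_set q P <= alpha * r.

Definition closed_paraconvex (alpha : R) P : Prop :=
  nonempty_closed P /\ paraconvex alpha P.

Definition eps_selection (X : Type) (eps : R) (g : X -> Y) (phi : X -> set Y)
    : Prop :=
  forall x, dist_set (g x) (phi x) < eps.

(* A set [U : set X] used as a type is the subtype of its points with the
   subspace topology; [phi \o set_val] is the restriction of [phi] to it. *)
Definition DMP (X : topologicalType) (phi : X -> set Y) : Prop :=
  (exists psi : X -> set Y,
     [/\ lsc psi, forall x, nonempty_compact (psi x) & multi_selection psi phi])
  /\
  (forall (eps : R) (U : set X) (g : U -> Y),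
     0 < eps -> cozero_set R U -> continuous g ->
     eps_selection eps g (phi \o set_val) ->
     exists psi : U -> set Y,
       [/\ lsc psi, forall x, nonempty_compact (psi x)
         & forall x, psi x `<=` closure (phi (set_val x) `&` ball (g x) eps)]).

End NormedSpace.

Definition continuous_selection (X Y : topologicalType) (f : X -> Y)
    (phi : X -> set Y) : Prop :=
  continuous f /\ forall x, phi x (f x).

(* Main.v *)
Require Import Defs.
From HB Require Import structures.
From mathcomp Require Import all_boot all_order all_algebra.
From mathcomp Require Import all_classical all_reals all_analysis.
From mathcomp Require Import ring lra zify.
Import Order.TTheory GRing.Theory Num.Theory.
Import numFieldNormedType.Exports.
Local Open Scope classical_set_scope.
Local Open Scope ring_scope.

(** Everything rests on one construction of continuous maps. Let a point-finite
    open cover of a [tau]-PF-normal space [X], of cardinality at most [tau], be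
    given, together with a point of a normed space for each of its members.
    Then some continuous map sends every [x] into each convex set that contains
    the points attached to the members around [x]
    ([PF_normal_convex_selection]). The reason is that a normal sequence
    carries uniformly Lipschitz bump functions, one for each member of the
    cover ([normal_sequence_function]). For a family that is uniformly
    Lipschitz, point-finiteness of the supports turns into local finiteness
    once the bumps are cut down by a constant, and a locally finite family can
    be normalized into a partition of unity.

    Point-finite covers of [X] come from l.s.c. compact-valued maps [psi]: a
    compact set meets only finitely many members of a locally finite family,
    so the sets of those [x] for which [psi x] meets [V], with [V] in a locally
    finite open cover of [Y] of small mesh, form a point-finite open cover.
    Such covers of [Y] with index set [tau * nat] are provided by Stone's
    theorem ([locally_finite_open_refinement]), and [tau * nat] is no larger
    than [tau].

    Let now [g] be continuous with [g x] at distance less than [r x] from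
    [phi x], where [r] is a positive continuous function. The second half of
    the DMP, used on the cozero-sets where [r] is nearly constant, gives maps
    [psi] whose values lie in the part of [phi x] within about [r x] of
    [g x]. The construction above then yields a continuous [f] such that [f x]
    is close to the convex hull of that part, so by paraconvexity [f x] is at
    distance at most about [alpha * r x], hence less than
    [(1 + alpha) / 2 * r x], from [phi x], while [f] has moved from [g] by less
    than [2 * r x] ([DMP_selection_step]). Iterating gives a locally uniformly
    Cauchy sequence whose limit is a selection at distance at most
    [4 / (1 - alpha) * r x] from [g x] ([DMP_selection]).

    With [r] constant this is the second claim. For the first one takes
    [g = 0]: all that is needed is a continuous function that exceeds the
    distance from [0] to [phi x], and the first half of the DMP gives one
    ([compact_multi_selection_bound]). Allowing [r] to vary is what makes
    the first claim a special case. *)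

(** * Powers of a number below one *)

Lemma expr_lt_eps (R : realType) (b e : R) :
  0 < b < 1 -> 0 < e -> exists n, b ^+ n < e.
Proof.
move=> /andP[b0 b1] e0; have : (fun n => b ^+ n) @ \oo --> (0 : R).
  by apply: cvg_expr; rewrite gtr0_norm.
move=> /cvgrPdist_lt/(_ _ e0)[n _ /(_ n (leqnn n))].
by rewrite sub0r normrN ger0_norm ?exprn_ge0 ?(ltW b0)//; exists n.
Qed.

Lemma half_in01 (R : realType) : 0 < (2^-1 : R) < 1.
Proof. by apply/andP; split; lra. Qed.

Lemma half_exp_le (R : realType) m n :
  (m <= n)%N -> 2^-1 ^+ n <= 2^-1 ^+ m :> R.
Proof.
by move=> mn; apply: ler_wiXn2l; rewrite ?invr_ge0// invf_le1// ler1n.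
Qed.

(** * A product of an infinite cardinal with the natural numbers *)

Lemma card_setT_leP (T U : Type) (A : set U) :
  ([set: T] #<= A)%card <-> exists2 f : T -> U, injective f & forall t, A (f t).
Proof.
split=> [/card_leP[f]|[f finj fA]].
  exists (fun t => set_val (f (to_setT t))); last first.
    by move=> t; apply: set_mem; exact: (valP (f (to_setT t))).
  by move=> s t /val_inj/(@inj _ _ _ f); rewrite !inE => /(_ I I)/(congr1 val).
apply/card_leP/injfunPex.
exists (fun t => exist (fun x => x \in A) (f (set_val t))
  (mem_set (fA _))) => //.
by move=> s t _ _ /(congr1 val)/finj/val_inj.
Qed.

(** A maximal disjoint family of ranges of injective sequences covers [T] up to
    a finite set, whose elements can be absorbed into one of the sequences.
    Thus every element is coded by a sequence of the family and a position,
    and a pair with a second natural number is coded by another position in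
    the same sequence. *)
Lemma infinite_prod_nat_card_le (T : Type) :
  infinite_set [set: T] -> ([set: T * nat] #<= [set: T])%card.
Proof.
move=> infT.
have [E [Einj Etriv Emax]] :=
  @ex_maximal_disjoint_subcollection (nat -> T) T (fun f : nat -> T => range f)
    [set f : nat -> T | injective f].
pose rest := ~` \bigcup_(f in E) range f.
have finR : finite_set rest.
  apply: contrapT => /infiniteP/card_setT_leP[f finj fR].
  have fE : ~ E f.
    by move=> Ef; have := fR 0; apply; exists f => //; exists 0.
  apply: (Emax (f |` E)).
  - split; first by move=> g Eg; right.
    by move=> sub; apply: fE; apply: sub; left.
  - by move=> g [->//|]; exact: Einj.
  - move=> g h Eg Eh [y [gy hy]].
    have abs k : E k -> range k y -> range f y -> False.
      by move=> Ek ky [i _ fi]; have := fR i; apply; exists k; rewrite ?fi.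
    case: Eg => [gf|Eg]; case: Eh => [hf|Eh].
    + by rewrite gf hf.
    + by exfalso; apply: (abs h) => //; rewrite -gf.
    + by exfalso; apply: (abs g) => //; rewrite -hf.
    + by apply: Etriv => //; exists y.
have [f0 Ef0] : exists f, E f.
  apply: contrapT => noE; apply: infT.
  by apply: (sub_finite_set _ finR) => t _ [f Ef _]; apply: noE; exists f.
have /countable_injP[j jinj] := finite_set_countable finR.
(* The remainder is coded inside the range of [f0]; [inl] and [inr] keep the
   two kinds of positions apart. *)
have code t : exists c : (nat -> T) * (nat + nat), E c.1 /\
    match c.2 with inl n => t = c.1 n | inr n => rest t /\ n = j t end.
  have [[f Ef [n _ fnt]]|Rt] := pselect ((\bigcup_(f in E) range f) t).
    by exists (f, inl n).
  by exists (f0, inr (j t)).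
have {code}[c cP] := choice code.
apply/card_setT_leP.
exists (fun p => (c p.1).1 (pickle ((c p.1).2, p.2))) => //.
move=> [t k] [s l] /= eq_c.
have [Et ct] := cP t; have [Es cs] := cP s.
have eqE : (c t).1 = (c s).1.
  apply: Etriv => //; exists ((c t).1 (pickle ((c t).2, k))).
  by split; [exists (pickle ((c t).2, k))|exists (pickle ((c s).2, l))].
move: eq_c; rewrite eqE => eq_c.
have [eq2 ->] := pcan_inj pickleK (Einj _ Es _ _ eq_c).
congr pair; move: ct cs; rewrite eqE eq2.
case: (c s).2 => n; first by move=> tn sn; rewrite tn [RHS]sn.
by move=> [Rt nt] [Rs ns]; apply: jinj; rewrite ?inE// -nt -ns.
Qed.

(** * Bump functions of a normal sequence *)

Section Chains.
Context {R : realType} {X : Type}.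
Variable E : nat -> X -> X -> Prop.
Implicit Types (p q : seq (nat * X)) (x y z : X).

(** A chain from [x] is a list of links [(n, y)], each one leading to [y] by a
    step of [E n], a step which is charged [2^-n]. *)
Fixpoint linked x p : Prop :=
  if p is (n, y) :: q then E n x y /\ linked y q else True.

Definition endpoint x p : X := last x (unzip2 p).

Definition cost p : R := \sum_(a <- p) 2^-1 ^+ a.1.

Lemma cost_cons a p : cost (a :: p) = 2^-1 ^+ a.1 + cost p.
Proof. by rewrite /cost big_cons. Qed.

Lemma cost_cat p q : cost (p ++ q) = cost p + cost q.
Proof. by rewrite /cost big_cat. Qed.

Lemma cost_ge0 p : 0 <= cost p.
Proof. by apply: sumr_ge0 => a _; apply: exprn_ge0; rewrite invr_ge0. Qed.

Lemma endpoint_cat x p q : endpoint x (p ++ q) = endpoint (endpoint x p) q.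
Proof. by rewrite /endpoint /unzip2 map_cat last_cat. Qed.

Lemma linked_cat x p q :
  linked x (p ++ q) <-> linked x p /\ linked (endpoint x p) q.
Proof.
elim: p x => [x|[n y] p IHp x] /=; first by split=> [|[]].
by rewrite IHp /endpoint /=; split=> [[? []]|[[]]].
Qed.

Lemma cost_split p (t : R) : 0 <= t < cost p ->
  exists p1 a p2, p = p1 ++ a :: p2 /\ cost p1 <= t < cost p1 + 2^-1 ^+ a.1.
Proof.
elim: p t => [t|a p IHp t].
  by rewrite /cost big_nil; move=> /andP[/le_lt_trans/[apply]]; rewrite ltxx.
rewrite cost_cons => /andP[t0 tlt].
have [ta|at_] := ltP t (2^-1 ^+ a.1).
  by exists [::], a, p; rewrite /cost big_nil add0r t0.
have [|p1 [b [p2 [-> /andP[h1 h2]]]]] := IHp (t - 2^-1 ^+ a.1).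
  by rewrite subr_ge0 at_ ltrBlDl.
exists (a :: p1), b, p2; split => //; rewrite cost_cons.
by rewrite -lerBrDl h1 /= -addrA -ltrBlDl.
Qed.

Hypothesis E_refl : forall n x, E n x x.
Hypothesis E_split : forall n x y z w,
  E n.+1 x y -> E n.+1 y z -> E n.+1 z w -> E n x w.

Lemma entourage_le m n x y : (m <= n)%N -> E n x y -> E m x y.
Proof.
move=> mn; rewrite -(subnK mn); elim: (n - m)%N => //= k IHk Exy.
by apply: IHk; apply: E_split Exy _ _; exact: E_refl.
Qed.

(** Frink's metrization lemma. Cutting a chain at half of its cost leaves two
    shorter chains of at most half the cost and one link, each of which is by
    induction a step of [E m.+1]; three of these make one step of [E m]. *)
Lemma linked_cost_lt m x p : linked x p -> cost p < 2^-1 ^+ m ->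
  E m x (endpoint x p).
Proof.
have [k] := ubnP (size p); elim: k => // k IHk in m x p *; rewrite ltnS => sp.
move=> lp cp; have [p0|p0] := leP (cost p) 0.
  case: p p0 {sp lp cp} => [_|a p]; first exact: E_refl.
  rewrite cost_cons; have := cost_ge0 p.
  by have : 0 < 2^-1 ^+ a.1 :> R by []; lra.
have [|p1 [[n y] [p2 [pE /= /andP[c1 c2]]]]] := @cost_split p (cost p / 2).
  by apply/andP; split; lra.
move: sp lp cp c1 c2; rewrite pE size_cat /= cost_cat cost_cons endpoint_cat.
rewrite linked_cat /= => sp [l1 [Exy l2]] cp c1 c2.
have expS : 2^-1 ^+ m.+1 = 2^-1 ^+ m / 2 :> R by rewrite exprSr.
have nm : (m < n)%N.
  rewrite ltnNge; apply/negP => nm.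
  have := half_exp_le R _ _ nm.
  by have := cost_ge0 p1; have := cost_ge0 p2; lra.
apply: (@E_split _ _ (endpoint x p1) y).
- by apply: IHk => //; [lia|rewrite expS; lra].
- exact: entourage_le Exy.
- by apply: IHk => //; [lia|rewrite expS; lra].
Qed.

End Chains.

(** The function [h] is the distance to the complement of [U], truncated at
    [1/2], for the pseudometric defined by the cheapest chains. Its Lipschitz
    estimate does not depend on [U], which is what local finiteness of the
    bumps of a whole cover will be deduced from. *)
Lemma normal_sequence_function (R : realType) (X : topologicalType)
    (W : nat -> set (set X)) (U : set X) : normal_sequence W ->
  exists h : X -> R, [/\ forall x, 0 <= h x, forall x, ~ U x -> h x = 0,
    forall n A x y, W n A -> A x -> A y -> h x <= h y + 2^-1 ^+ n &
    forall A x, W 1%N A -> A x -> star A (W 1%N) `<=` U -> 2^-1 <= h x].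
Proof.
move=> [Wcov Wstar].
pose E n x y := exists2 A, W n A & A x /\ A y.
have E_refl n x : E n x x.
  by have [_ /seteqP[_ /(_ x I)[A WA Ax]]] := Wcov n; exists A.
have E_split n x y z w : E n.+1 x y -> E n.+1 y z -> E n.+1 z w -> E n x w.
  move=> [A WA [Ax Ay]] [B WB [By Bz]] [C WC [Cz Cw]].
  have [V WV BV] := Wstar n B WB; exists V => //.
  by split; apply: BV; [exists A|exists C] => //; split => //;
    [exists y|exists z].
pose S x := [set 2^-1] `|` [set cost p | p in
  [set p | linked E x p /\ ~ U (endpoint x p)]] : set R.
have Sge0 x s : S x s -> 0 <= s.
  by move=> [->|[p _ <-]]; [rewrite invr_ge0|exact: cost_ge0].
have Slb x : has_lbound (S x) by exists 0 => s /Sge0.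
have Sn0 x : S x !=set0 by exists 2^-1; left.
have hge0 x : 0 <= inf (S x) by apply: lb_le_inf => // s /Sge0.
exists (fun x => inf (S x)); split => //.
- move=> x Ux; apply/eqP; rewrite eq_le hge0 andbT; apply: ge_inf => //.
  by right; exists [::]; [|rewrite /cost big_nil].
- move=> n A x y WA Ax Ay; rewrite -lerBlDr; apply: lb_le_inf => // s.
  case=> [->|[p [lp Up] <-]]; rewrite lerBlDr.
    apply: (@le_trans _ _ 2^-1); first by apply: ge_inf => //; left.
    by rewrite lerDl exprn_ge0// invr_ge0.
  rewrite addrC; apply: ge_inf => //; right; exists ((n, y) :: p).
    by split=> //=; split=> //; exists A.
  by rewrite cost_cons.
- move=> A x WA Ax AU; apply: lb_le_inf => // s [->//|[p [lp Up] <-]].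
  rewrite leNgt; apply/negP => cp; apply: Up; apply: AU.
  have [|B WB [Bx Be]] := @linked_cost_lt R X E E_refl E_split 1 x p lp.
    by rewrite expr1.
  by exists B => //; split=> //; exists x.
Qed.

(** * Convex combinations *)

Lemma convex_setP (R : realType) (Y : lmodType R)
    (C : set (convex_lmodType Y)) :
  convex_set C <-> forall (x y : Y) (a b : R), C x -> C y -> 0 <= a -> 0 <= b ->
    a + b = 1 -> C (a *: x + b *: y).
Proof.
split=> [cC x y a b Cx Cy a0 b0 ab|cC x y l /set_mem Cx /set_mem Cy].
  have a1 : a <= 1 by rewrite -ab lerDl.
  have := cC x y (Itv01 a0 a1) (mem_set Cx) (mem_set Cy).
  rewrite /conv/= /unstable.onem inE.
  by have <- : b = 1 - a by rewrite -ab addrAC subrr add0r.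
apply/mem_set; apply: cC => //; rewrite /unstable.onem ?subr_ge0 ?ge0 ?le1 //.
by rewrite addrC subrK.
Qed.

Lemma convex_set_sum (R : realType) (Y : lmodType R)
    (C : set (convex_lmodType Y)) (I : eqType) (s : seq I) (w : I -> R)
    (y : I -> Y) :
  convex_set C -> (forall i, 0 <= w i) -> (forall i, i \in s -> C (y i)) ->
  0 < \sum_(i <- s) w i ->
  C ((\sum_(i <- s) w i)^-1 *: (\sum_(i <- s) w i *: y i)).
Proof.
move=> /convex_setP cC w0; elim: s => [|i s IHs] Cy.
  by rewrite big_nil ltxx.
rewrite !big_cons; set S := \sum_(j <- s) w j => S0.
have S_ge0 : 0 <= S by apply: sumr_ge0.
have [SE|SN] := eqVneq S 0.
  have -> : \sum_(j <- s) w j *: y j = 0.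
    rewrite big1_seq// => j /= js; have : w j <= S.
      by rewrite /S (big_rem j)//= lerDl sumr_ge0.
    rewrite SE => wj; rewrite (_ : w j = 0) ?scale0r//.
    by apply/eqP; rewrite eq_le wj w0.
  rewrite SE !addr0 scalerA mulVf ?scale1r.
    by apply: Cy; rewrite mem_head.
  by move: S0; rewrite SE addr0 => /lt0r_neq0.
rewrite scalerDr scalerA.
have -> : (w i + S)^-1 *: (\sum_(j <- s) w j *: y j) =
   (S / (w i + S)) *: (S^-1 *: \sum_(j <- s) w j *: y j).
  by rewrite scalerA mulrAC divff// mul1r.
apply: cC; first by apply: Cy; rewrite mem_head.
- apply: IHs; last by rewrite lt_neqAle eq_sym SN.
  by move=> j js; apply: Cy; rewrite inE js orbT.
- by rewrite mulr_ge0// invr_ge0 ltW.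
- by rewrite mulr_ge0// invr_ge0 ltW.
- by rewrite [_^-1 * _]mulrC -mulrDl divff// lt0r_neq0.
Qed.

(** * Continuous maps subordinate to a point-finite cover *)

Lemma locally_finite_sum_continuous (R : realType) (I : choiceType)
    (X : topologicalType) (Y : normedModType R) (F : I -> X -> Y) :
  (forall i, continuous (F i)) ->
  (forall x : X, exists2 S : set I, finite_set S &
     \forall z \near x, forall i, ~ S i -> F i z = 0) ->
  continuous (fun x => \sum_(i \in [set: I]) F i x).
Proof.
move=> cF locF x; have [S finS nearS] := locF x.
have sumE z : (forall i, ~ S i -> F i z = 0) ->
    \sum_(i \in [set: I]) F i z =
    \sum_(i <- finmap.enum_fset (fset_set S)) F i z.
  move=> Fz; apply: fsbigTE => i; rewrite in_fset_set// notin_setE.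
  exact: Fz.
have Fx : forall i, ~ S i -> F i x = 0 by exact: nbhs_singleton nearS.
rewrite /continuous_at (sumE _ Fx).
apply: cvg_trans; last first.
  apply: (@continuous_big Y I +%R 0 xpredT _ X
    (finmap.enum_fset (fset_set S)) F) => //.
  by move=> p; apply: cvgD; [exact: cvg_fst|exact: cvg_snd].
by apply: near_eq_cvg; apply: filterS nearS => z /sumE.
Qed.

(** Since the bumps of all members are [1/4]-close between points of a common
    member of [W 2], the bumps cut down by [1/4] that are non-zero near [x]
    belong to members that contain [x]. There are finitely many of these, so
    the cut bumps can be summed and used as weights. They do not vanish
    simultaneously because a star of [W 1] lies inside some member, where the
    bump is at least [1/2]. *)
Lemma PF_normal_convex_selection (R : realType) (tau I : Type)
    (X : topologicalType) (Y : normedModType R) (O : I -> set X) (y : I -> Y) :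
  PF_normal tau X -> ([set: I] #<= [set: tau])%card ->
  (forall i, open (O i)) -> (forall x, exists i, O i x) ->
  (forall x, finite_set [set i | O i x]) ->
  exists2 f : X -> Y, continuous f &
    forall x (C : set (convex_lmodType Y)), convex_set C ->
      (forall i, O i x -> C (y i)) -> C (f x).
Proof.
move=> [_ PFX] Itau Oopen Ocov Ofin; pose U := range O.
have Upf : point_finite U.
  move=> x; apply: sub_finite_set (finite_image O (Ofin x)).
  by move=> _ [[i _ <-] Oix]; exists i.
have [W nW UW] : normal_cover U.
  apply: PFX => //; last by apply: card_le_trans Itau; exact: card_image_le.
  split; first by move=> _ [i _ <-].
  apply/seteqP; split => // x _; have [i Oix] := Ocov x.
  by exists (O i) => //; exists i.
have /choice[z zP] : forall A : set X, exists v : Y,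
    U A -> exists2 i, O i = A & v = y i.
  move=> A; have [[i _ OiA]|nUA] := pselect (U A); last by exists 0.
  by exists (y i) => _; exists i.
have /choice[k kP] : forall A : set X, exists k : X -> R,
    [/\ continuous k, forall x, 0 <= k x,
      forall B x t, W 2 B -> B x -> B t -> 0 < k t -> U A /\ A x &
      U A -> forall B x, W 1 B -> B x -> star B (W 1) `<=` A -> 0 < k x].
  move=> A; have [UA|nUA] := pselect (U A); last first.
    exists (fun=> 0); split=> //; first by move=> x; exact: cvg_cst.
    by move=> ? ? ? _ _ _; rewrite ltxx.
  have [h [h0 hA hlip h1]] := @normal_sequence_function R X W A nW.
  have hcont : continuous h.
    move=> x; apply/cvgrPdist_lt => e e0.
    have [n ne] := expr_lt_eps R _ _ (half_in01 R) e0.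
    have [Wcov _] := nW; have [Wo Wc] := Wcov n.
    have [B WB Bx] : (\bigcup_(B in W n) B) x by rewrite Wc.
    have : nbhs x B by apply: open_nbhs_nbhs; split=> //; exact: Wo.
    apply: filterS => t Bt; apply: le_lt_trans ne; rewrite ler_norml.
    by have := hlip n B x t WB Bx Bt; have := hlip n B t x WB Bt Bx; lra.
  exists (fun x => Num.max 0 (h x - 4^-1)); split.
  - move=> x; apply: (@continuous_max R X (cst 0) (fun x => h x - 4^-1) x).
      exact: cvg_cst.
    by apply: cvgB; [exact: hcont|exact: cvg_cst].
  - by move=> x; rewrite le_max lexx.
  - move=> B x t WB Bx Bt; rewrite lt_max ltxx /= => ht; split=> //.
    apply: contrapT => /hA hx; have := hlip 2 B t x WB Bt Bx; rewrite hx expr2.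
    by move: ht; lra.
  - move=> _ B x WB Bx BA; rewrite lt_max ltxx/=.
    by have := h1 B x WB Bx BA; lra.
have k_cont A : continuous (k A) by have [] := kP A.
have k_ge0 A x : 0 <= k A x by have [] := kP A.
have near_supp (x : X) :
    \forall t \near x, forall A, ~ (U A /\ A x) -> k A t = 0.
  have [Wcov _] := nW; have [Wo Wc] := Wcov 2.
  have [B WB Bx] : (\bigcup_(B in W 2) B) x by rewrite Wc.
  have : nbhs x B by apply: open_nbhs_nbhs; split=> //; exact: Wo.
  apply: filterS => t Bt A UA; apply/eqP; rewrite eq_le k_ge0 andbT leNgt.
  by apply/negP => kt; apply: UA; have [_ _ /(_ B x t WB Bx Bt kt)] := kP A.
have supp x A : ~ (U A /\ A x) -> k A x = 0.
  by move: A; exact: nbhs_singleton (near_supp x).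
pose S x := \sum_(A \in [set: set X]) k A x.
pose V x := \sum_(A \in [set: set X]) k A x *: z A.
pose s x := finmap.enum_fset (fset_set [set A | U A /\ A x]).
have SE x : S x = \sum_(A <- s x) k A x.
  by apply: fsbigTE => A; rewrite in_fset_set// notin_setE; exact: supp.
have VE x : V x = \sum_(A <- s x) k A x *: z A.
  apply: fsbigTE => A; rewrite in_fset_set// notin_setE /= => /supp ->.
  by rewrite scale0r.
have S0 x : 0 < S x.
  have [Wcov Wstar] := nW; have [Wo Wc] := Wcov 1.
  have [B WB Bx] : (\bigcup_(B in W 1) B) x by rewrite Wc.
  have [A WA BA] := Wstar 0 B WB; rewrite -UW in WA.
  have Ax : A x by apply: BA; exists B => //; split=> //; exists x.
  rewrite SE (big_rem A)/=; last by rewrite in_fset_set// inE.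
  rewrite ltr_pwDl ?sumr_ge0//.
  by have [_ _ _ /(_ WA B x WB Bx BA)] := kP A.
have S_cont : continuous S.
  apply: (@locally_finite_sum_continuous R _ X R^o k) => // x.
  by exists [set A | U A /\ A x].
have V_cont : continuous V.
  apply: (@locally_finite_sum_continuous R _ X Y (fun A x => k A x *: z A)).
    by move=> A x; apply: cvgZr_tmp; exact: k_cont.
  move=> x; exists [set A | U A /\ A x] => //.
  by apply: filterS (near_supp x) => t kt A /kt ->; rewrite scale0r.
exists (fun x => (S x)^-1 *: V x).
  move=> x; apply: cvgZ; last exact: V_cont.
  by apply: cvgV; [rewrite gt_eqF|exact: S_cont].
move=> x C cC Cy; rewrite SE VE; apply: convex_set_sum => //.
  move=> A; rewrite in_fset_set// inE => -[/= UA Ax].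
  by have [i OiA ->] := zP A UA; apply: Cy; rewrite OiA.
by rewrite -SE.
Qed.

(** * Locally finite covers of metric spaces *)

Lemma well_order_lt (T : Type) : exists lt : T -> T -> Prop,
  (forall s t, s <> t -> lt s t \/ lt t s) /\
  forall A : set T, A !=set0 -> exists2 m, A m & forall s, lt s m -> ~ A s.
Proof.
elim/Peq: T => T; have [le le_wo] := wochoice.well_ordering_principle T.
have le_min (A : pred T) a : A a -> exists2 m, A m & forall s, A s -> le m s.
  by move=> Aa; have [|m [[mA ml] _]] := le_wo A; [exists a|exists m].
have le_refl s : le s s.
  by have [m /eqP -> ml] := le_min (pred1 s) s (eqxx s); exact: ml (eqxx s).
have le_anti s t : le s t -> le t s -> s = t.
  move=> st ts; have [|m [_ muniq]] := le_wo [pred x | (x == s) || (x == t)].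
    by exists s; rewrite inE eqxx.
  rewrite -(muniq s) ?(muniq t)//; split; rewrite ?inE ?eqxx ?orbT//.
  - by move=> x; rewrite inE => /orP[/eqP ->|/eqP ->].
  - by move=> x; rewrite inE => /orP[/eqP ->|/eqP ->].
exists (fun s t => le s t /\ s <> t); split=> [s t st|A [a Aa]].
  have [|m] := le_min [pred x | (x == s) || (x == t)] s.
    by rewrite /= eqxx.
  move=> /orP[/eqP ->|/eqP ->] ml.
    by left; split=> //; apply: ml; rewrite /= eqxx orbT.
  by right; split=> [|/esym//]; apply: ml; rewrite /= eqxx.
have [|m /asboolP mA ml] := le_min [pred x | `[< A x >]] a; first exact/asboolP.
exists m => // s [sm neq] As; apply: neq; apply: le_anti => //.
by apply: ml; exact/asboolP.
Qed.

(** Mary Ellen Rudin's proof that metric spaces are paracompact. The set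
    [stone_cover t n] is a union of balls of radius [2^-n], whose centres
    have [C t] as the first member of the cover around them, lie deep inside
    [C t], and have not been covered at an earlier stage. *)
Section Stone.
Context {R : realType} {Y : pseudoMetricType R} {T : Type}.
Variables (C : T -> set Y) (lt : T -> T -> Prop).
Implicit Types (prev : set Y) (t : T) (x : Y) (n : nat).

Definition stone_centers t n prev : set Y :=
  [set x | (forall s, lt s t -> ~ C s x) /\ ~ prev x /\
           ball x (3 * 2^-1 ^+ n) `<=` C t].

(** Interiors are taken because balls of a pseudometric structure need not be
    open. *)
Definition stone_layer t n prev : set Y :=
  \bigcup_(x in stone_centers t n prev) (ball x (2^-1 ^+ n : R))°.

Fixpoint stone_prev n : set Y :=
  if n is m.+1 then
    stone_prev m `|` \bigcup_t stone_layer t m (stone_prev m)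
  else set0.

Definition stone_cover t n : set Y := stone_layer t n (stone_prev n).

Lemma stone_prevP n x :
  stone_prev n x <-> exists m t, (m < n)%N /\ stone_cover t m x.
Proof.
elim: n => [|n IHn] /=; first by split=> [|[m [t []]]].
split=> [[/IHn[m [t [mn Vx]]]|[t _ Vx]]|[m [t []]]].
- by exists m, t; split=> //; exact: ltnW.
- by exists n, t.
- rewrite ltnS leq_eqVlt => /orP[/eqP ->|mn] Vx; first by right; exists t.
  by left; apply/IHn; exists m, t.
Qed.

Let half_le m n : (m < n)%N -> 2 * 2^-1 ^+ n <= 2^-1 ^+ m :> R.
Proof.
case: n => // n; rewrite ltnS => mn; rewrite exprS mulrA divff// mul1r.
exact: half_exp_le.
Qed.

Hypothesis C_open : forall t, open (C t).
Hypothesis C_cover : forall x, exists t, C t x.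
Hypothesis lt_total : forall s t, s <> t -> lt s t \/ lt t s.
Hypothesis lt_min :
  forall A : set T, A !=set0 -> exists2 m, A m & forall s, lt s m -> ~ A s.

Lemma stone_cover_open t n : open (stone_cover t n).
Proof. by apply: bigcup_open => x _; exact: open_interior. Qed.

Lemma stone_cover_sub t n : stone_cover t n `<=` C t.
Proof.
move=> y [x [_ [_ xC]] /interior_subset xy]; apply: xC.
apply: le_ball xy; rewrite ler_peMl ?ler1n//.
Qed.

Lemma stone_cover_cover x : exists t n, stone_cover t n x.
Proof.
have [t Ctx tmin] := lt_min [set t | C t x] (C_cover x).
have : nbhs x (C t) by apply: open_nbhs_nbhs.
move=> /nbhs_ballP[e /= e0 eC].
have [n ne] : exists n, 2^-1 ^+ n < e / 3.
  by apply: expr_lt_eps; [exact: half_in01|rewrite divr_gt0].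
have [/stone_prevP[m [s [_ sx]]]|px] := pselect (stone_prev n x).
  by exists s, m.
exists t, n, x; last by apply: nbhsx_ballx.
split=> //; split=> //; apply: subset_trans eC; apply: le_ball.
by rewrite mulrC -ler_pdivlMr// ltW.
Qed.

(** Let the ball of radius [2^-j] around [x] lie in [stone_cover t0 n0]. The
    centres of the stages after [n0] avoid that ball, so small balls around
    [x] meet no layer of stage [n0 + j + 1] or later. At each earlier stage,
    centres belonging to different indices [s] before [u] are at least
    [3 * 2^-i] apart, because the ball of that radius around the former lies
    in [C s] and the latter is outside [C s]; hence a small ball meets at most
    one layer of that stage. *)
Lemma stone_cover_locally_finite x : exists2 N : set Y, nbhs x N &
  finite_set [set p : T * nat | stone_cover p.1 p.2 `&` N !=set0].
Proof.
have [t0 [n0 x0]] := stone_cover_cover x.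
have : nbhs x (stone_cover t0 n0).
  by apply: open_nbhs_nbhs; split=> //; exact: stone_cover_open.
move=> /nbhs_ballP[e /= e0 eV].
have [j je] := expr_lt_eps R _ _ (half_in01 R) e0.
pose K := (n0 + j).+1.
exists (ball x (2^-1 ^+ K)); first by apply: nbhsx_ballx.
set S := [set p : T * nat | _].
have S_lt p : S p -> (p.2 < K)%N.
  move=> [q [[y [_ [yprev _]] /interior_subset yq] xq]].
  rewrite ltnNge; apply/negP => Kp; apply: yprev; apply/stone_prevP.
  exists n0, t0; split; first by apply: leq_trans Kp; rewrite ltnS leq_addr.
  apply: eV; apply: (le_ball (ltW je)).
  have := ball_triangle xq (ball_sym yq); apply: le_ball.
  have jK : (j < K)%N by rewrite ltnS leq_addl.
  by have := half_le _ _ jK; have := half_exp_le R _ _ Kp; lra.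
have S_inj : {in S &, injective snd}.
  have aux s u i : S (s, i) -> S (u, i) -> lt s u -> False.
    move=> Ss Su su; have iK := S_lt _ Ss.
    case: Ss => p [[y [_ [_ yC]] /interior_subset yp] xp].
    case: Su => q [[z [zC _] /interior_subset zq] xq].
    apply: (zC s su); apply: yC.
    have := ball_triangle (ball_triangle (ball_triangle yp (ball_sym xp)) xq)
      (ball_sym zq).
    by apply: le_ball; have := half_le _ _ iK; lra.
  move=> [s i] [u k] /set_mem Ss /set_mem Su /= ik; rewrite -ik in Su *.
  congr pair; apply: contrapT => /lt_total[su|us].
    exact: (aux s u i).
  exact: (aux u s i).
rewrite -(eq_finite_set (inj_card_eq S_inj)).
by apply: (sub_finite_set _ (finite_II K)) => _ [p /S_lt ? <-].
Qed.

End Stone.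

Theorem locally_finite_open_refinement (R : realType) (Y : pseudoMetricType R)
    (T : Type) (C : T -> set Y) :
  (forall t, open (C t)) -> (forall x, exists t, C t x) ->
  exists V : T -> nat -> set Y, [/\ forall t n, open (V t n),
    forall t n, V t n `<=` C t, forall x, exists t n, V t n x &
    forall x : Y, exists2 N : set Y, nbhs x N &
      finite_set [set p : T * nat | V p.1 p.2 `&` N !=set0]].
Proof.
move=> Co Cc; have [lt [lt_total lt_min]] := well_order_lt T.
exists (stone_cover C lt); split.
- exact: stone_cover_open.
- exact: stone_cover_sub.
- exact: stone_cover_cover.
- exact: stone_cover_locally_finite.
Qed.

(** Compactness is applied to the cofinite filter on the indices: near each
    point, all but finitely many indices are avoided. *)
Lemma compact_locally_finite (Y : topologicalType) (I : Type) (V : I -> set Y)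
    (K : set Y) :
  (forall y : Y, exists2 N : set Y, nbhs y N &
     finite_set [set i | V i `&` N !=set0]) ->
  compact K -> finite_set [set i | K `&` V i !=set0].
Proof.
move=> locV /compact_near_coveringP Kcov.
pose F : set_system I := [set A | finite_set (~` A)].
have FF : Filter F.
  split; first by rewrite /F /= setCT.
    by move=> P Q FP FQ; rewrite /F /= setCI finite_setU.
  by move=> P Q /subsetC; exact: sub_finite_set.
have : F [set i | K `<=` [set y | ~ V i y]].
  apply: (Kcov I F (fun i y => ~ V i y) FF) => y _.
  have [N Ny finN] := locV y.
  exists (N, [set i | ~ (V i `&` N !=set0)]) => /=.
    by split=> //; apply: sub_finite_set finN => i /=; exact: contrapT.
  by move=> [z i] [/= Nz ViN] Viz; apply: ViN; exists z.
by apply: sub_finite_set => i [y [Ky Viy]] /(_ y Ky).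
Qed.

Lemma weight_dense (R : realType) (tau : Type) (Y : normedModType R) :
  weight_le Y tau ->
  exists d : tau -> Y,
    forall (y : Y) (e : R), 0 < e -> exists t, `|y - d t| < e.
Proof.
move=> [B [Bopen Bbase] Btau].
have [f finj _] :
    exists2 f : B -> tau, injective f & forall b, [set: tau] (f b).
  by apply/card_setT_leP; rewrite (card_le_eql (card_setT B)).
have /choice[d dP] : forall t, exists y : Y,
    forall b : B, f b = t -> set_val b !=set0 -> set_val b y.
  move=> t; have [[b [bt [y by_]]]|none] :=
    pselect (exists b : B, f b = t /\ set_val b !=set0).
    by exists y => c ct _; have /finj -> : f c = f b by rewrite ct.
  by exists 0 => b bt b0; exfalso; apply: none; exists b.
exists d => y e e0.
have [U [BU Uy] Usub] := Bbase y (ball y e) (nbhsx_ballx y e e0).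
exists (f (exist _ U (mem_set BU))).
have : ball y e (d (f (exist _ U (mem_set BU)))).
  by apply: Usub; apply: (dP _ (exist _ U (mem_set BU))) => //; exists y.
by rewrite -ball_normE.
Qed.

(** * Distance to a paraconvex set *)

Lemma convex_combination_lt (R : realDomainType) (a b u v e : R) :
  0 <= a -> 0 <= b -> a + b = 1 -> u < e -> v < e -> a * u + b * v < e.
Proof.
move=> a0 b0 ab ue ve; apply: (@le_lt_trans _ _ (Num.max u v)).
  rewrite -[leRHS]mul1r -ab mulrDl.
  by apply: lerD; apply: ler_wpM2l => //; rewrite le_max lexx ?orbT.
by rewrite gt_max ue ve.
Qed.

Section DistSet.
Context {R : realType} {Y : normedModType R}.
Implicit Types (p q : Y) (P : set Y).

Lemma dist_set_ge0 p P : 0 <= dist_set p P.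
Proof.
have [[q Pq]|/nonemptyPn ->] := pselect (P !=set0).
  by apply: lb_le_inf => [|_ [? _ <-]//]; exists `|p - q|, q.
by rewrite /dist_set image_set0 inf0.
Qed.

Lemma dist_set_le p q P : P q -> dist_set p P <= `|p - q|.
Proof.
by move=> Pq; apply: ge_inf; [exists 0 => _ [? _ <-]|exists q].
Qed.

Lemma dist_set_lt p P (e : R) : P !=set0 -> dist_set p P < e ->
  exists2 q, P q & `|p - q| < e.
Proof.
move=> [q0 Pq0] /inf_lt[]; last by move=> _ [q Pq <-]; exists q.
by exists `|p - q0|, q0.
Qed.

Lemma dist_set_triangle p q P : P !=set0 ->
  dist_set p P <= `|p - q| + dist_set q P.
Proof.
move=> P0; rewrite -lerBlDl; apply: lb_le_inf.
  by case: P0 => v Pv; exists `|q - v|, v.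
move=> _ [v Pv <-]; rewrite lerBlDl; apply: le_trans (dist_set_le p v P Pv) _.
exact: ler_distD.
Qed.

Lemma closed_dist_set0 p P : closed P -> P !=set0 -> dist_set p P <= 0 -> P p.
Proof.
move=> Pcl P0 d0; rewrite ((closure_id P).1 Pcl) => B /nbhs_ballP[e /= e0 eB].
have [|q Pq pq] := dist_set_lt p P e P0.
  exact: le_lt_trans e0.
by exists q; split=> //; apply: eB; rewrite -ball_normE.
Qed.

Lemma convex_hull_convex P :
  convex_set (convex_hull P : set (convex_lmodType Y)).
Proof.
apply/convex_setP => x y a b Hx Hy a0 b0 ab C [cC PC].
by move/convex_setP: (cC) => /(_ x y a b); apply=> //; [exact: Hx|exact: Hy].
Qed.

Lemma sub_convex_hull P : P `<=` convex_hull P.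
Proof. by move=> x Px C [_ PC]; exact: PC. Qed.

Definition hull_neighbourhood P (e : R) : set Y :=
  [set q | exists2 p, convex_hull P p & `|q - p| < e].

Lemma convex_hull_neighbourhood P (e : R) :
  convex_set (hull_neighbourhood P e : set (convex_lmodType Y)).
Proof.
apply/convex_setP => x y a b [p Hp xp] [q Hq yq] a0 b0 ab.
exists (a *: p + b *: q).
  by move/convex_setP: (convex_hull_convex P); exact.
have -> : a *: x + b *: y - (a *: p + b *: q) = a *: (x - p) + b *: (y - q).
  by rewrite !scalerBr opprD addrACA.
apply: le_lt_trans (ler_normD _ _) _.
rewrite !normrZ (ger0_norm a0) (ger0_norm b0).
exact: convex_combination_lt.
Qed.

Lemma convex_ball_norm p (e : R) :
  convex_set ([set q | `|p - q| < e] : set (convex_lmodType Y)).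
Proof.
apply/convex_setP => x y a b /= px py a0 b0 ab.
have -> : p - (a *: x + b *: y) = a *: (p - x) + b *: (p - y).
  by rewrite !scalerBr addrACA -scalerDl ab scale1r -opprD.
apply: le_lt_trans (ler_normD _ _) _.
rewrite !normrZ (ger0_norm a0) (ger0_norm b0).
exact: convex_combination_lt.
Qed.

(** A continuous approximation reaches the convex hull only up to an error
    [e], which the distance function and the norm pass on unchanged. *)
Lemma paraconvex_hull_neighbourhood (alpha rho e : R) P p q :
  P !=set0 -> paraconvex alpha P -> dist_set p P < rho ->
  hull_neighbourhood (ball p rho `&` P) e q ->
  dist_set q P < alpha * rho + e /\ `|p - q| < rho + e.
Proof.
move=> P0 Ppara pr [v Hv qv].
have rho0 : 0 < rho by apply: le_lt_trans pr; exact: dist_set_ge0.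
split.
  apply: le_lt_trans (dist_set_triangle q v P P0) _.
  by have := Ppara rho p rho0 pr v Hv; lra.
have pv : `|p - v| < rho.
  apply: (Hv [set v | `|p - v| < rho]); split; first exact: convex_ball_norm.
  by move=> x [+ _]; rewrite -ball_normE.
by have := ler_distD v p q; rewrite (distrC v q); lra.
Qed.

End DistSet.

(** * Continuous approximations under the DMP *)

(** The second half of the DMP with the map on the subtype [U] transported to
    [X], so that the maps obtained for several cozero-sets can be combined.
    Openness in [U] becomes openness in [X] because [U] is open. *)
Lemma DMP_cozero (R : realType) (X : topologicalType) (Y : normedModType R)
    (phi : X -> set Y) (eps : R) (U : set X) (g : X -> Y) :
  DMP phi -> 0 < eps -> cozero_set R U -> continuous g ->
  (forall x, U x -> dist_set (g x) (phi x) < eps) ->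
  exists psi : X -> set Y,
    [/\ forall V, open V -> open [set x | U x /\ psi x `&` V !=set0],
      forall x, U x -> psi x !=set0 /\ compact (psi x) &
      forall x, U x -> psi x `<=` closure (phi x `&` ball (g x) eps)].
Proof.
move=> [_ dmp] eps0 cozU gc geps.
have openU : open U.
  have [h hc ->] := cozU; have := @open_comp X R h [set t | t != 0].
  by move=> /(_ (fun x _ => hc x)); apply; exact: open_neq.
have valc : continuous (set_val : U -> X) by exact: initial_continuous.
have gvc : continuous (g \o set_val : U -> Y).
  by move=> x; apply: continuous_comp; [exact: valc|exact: gc].
have gv_eps : eps_selection eps (g \o set_val : U -> Y) (phi \o set_val).
  by move=> x; apply: geps; exact: set_mem (valP x).
have [psi [psi_lsc psi_cpt psi_sub]] := dmp eps U _ eps0 cozU gvc gv_eps.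
pose u x (Ux : U x) : U := exist _ x (mem_set Ux).
have uE x (Ux : U x) (v : U) : set_val v = x -> v = u x Ux.
  by move=> vx; apply: val_inj.
exists (fun x => [set y | exists2 v : U, set_val v = x & psi v y]).
have psiE x (Ux : U x) :
    [set y | exists2 v : U, set_val v = x & psi v y] = psi (u x Ux).
  by apply/seteqP; split=> [y [v /uE ->]|y ?]//; exists (u x Ux).
split.
- move=> V oV; have [Z oZ ZE] := psi_lsc V oV.
  rewrite (_ : [set x | _] = U `&` Z); first exact: openI.
  apply/seteqP; split=> x [Ux].
    rewrite psiE => xV; split=> //.
    have : [set x | psi x `&` V !=set0] (u x Ux) by [].
    by rewrite -ZE.
  move=> Zx; split=> //; rewrite psiE.
  by have : (set_val @^-1` Z) (u x Ux) by []; rewrite ZE.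
- by move=> x Ux; rewrite psiE; have [[]] := psi_cpt (u x Ux).
- by move=> x Ux; rewrite psiE; exact: (psi_sub (u x Ux)).
Qed.

(** The level [s x = ln (r x) / L] measures [r] on a logarithmic scale on which
    a factor [rho] has length two. The DMP is used on the cozero-sets [U n]
    where [s] is within one of the integer [n], with the constant [eps n],
    which exceeds [r] on [U n] by a factor less than [rho], and with a locally
    finite cover of [Y] whose mesh [del n] is below [eta * r x] there. Each
    [x] lies in at most two of the [U n], so the sets obtained for the various
    [n] form together a point-finite cover of [X]. *)
Lemma DMP_approximation (R : realType) (tau : Type) (X : topologicalType)
    (Y : normedModType R) (phi : X -> set Y) (g : X -> Y) (r : X -> R)
    (rho eta : R) :
  infinite_set [set: tau] -> weight_le Y tau -> PF_normal tau X -> DMP phi ->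
  continuous g -> continuous r -> (forall x, 0 < r x) ->
  (forall x, dist_set (g x) (phi x) < r x) -> 1 < rho -> 0 < eta ->
  exists2 f : X -> Y, continuous f &
    forall x (C : set (convex_lmodType Y)), convex_set C ->
      (forall y v, phi x v -> `|g x - v| < rho * r x -> `|v - y| < eta * r x ->
        C y) -> C (f x).
Proof.
move=> inftau wY PFX dmp gc rc r0 gr rho1 eta0.
have rho0 : 0 < rho by apply: lt_trans rho1.
have [d dP] := weight_dense R tau Y wY.
pose L := ln rho / 2; have L0 : 0 < L by rewrite divr_gt0// ln_gt0.
pose s x := ln (r x) / L.
have rE x : r x = expR (L * s x).
  by rewrite /s mulrC divfK ?gt_eqF// lnK// posrE.
have sc : continuous s.
  move=> x; apply: cvgM; last exact: cvg_cst.
  by apply: (continuous_comp (rc x)); exact: continuous_ln.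
pose U (n : int) : set X := [set x | `|s x - n%:~R| < 1].
have cozU n : cozero_set R (U n).
  exists (fun x => Num.max 0 (1 - `|s x - n%:~R|)).
    move=> x.
    apply: (@continuous_max R X (cst 0) (fun x => 1 - `|s x - n%:~R|) x).
      exact: cvg_cst.
    apply: cvgB; first exact: cvg_cst.
    by apply: cvg_norm; apply: cvgB; [exact: sc|exact: cvg_cst].
  apply/seteqP; split=> x; rewrite /U /=.
    by rewrite -subr_gt0 => ux; rewrite gt_eqF// lt_max ux orbT.
  rewrite -subr_gt0; apply: contra_neqT; rewrite -leNgt => ux.
  by apply/max_idPl.
pose eps (n : int) := expR (L * (n%:~R + 1)).
pose del (n : int) := eta * expR (L * (n%:~R - 1)).
have rU n x : U n x -> r x < eps n /\ eps n < rho * r x /\ del n < eta * r x.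
  rewrite /U /= ltr_norml => /andP[n1 n2].
  have rhoE : rho = expR (L * 2) by rewrite /L divfK// lnK// posrE.
  rewrite /eps /del rhoE rE -expRD -mulrDr (ltr_pM2l eta0) !ltr_expR.
  by rewrite !ltr_pM2l//; split; [lra|split; lra].
have /choice[psi psiP] : forall n, exists psi : X -> set Y,
    [/\ forall V, open V -> open [set x | U n x /\ psi x `&` V !=set0],
      forall x, U n x -> psi x !=set0 /\ compact (psi x) &
      forall x, U n x -> psi x `<=` closure (phi x `&` ball (g x) (eps n))].
  move=> n; apply: DMP_cozero => //; first exact: expR_gt0.
  by move=> x /rU[rx _]; exact: lt_trans rx.
have /choice[V VP] : forall n, exists V : tau -> nat -> set Y,
    [/\ forall t k, open (V t k), forall t k, V t k `<=` ball (d t) (del n),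
      forall y, exists t k, V t k y &
      forall y : Y, exists2 N : set Y, nbhs y N &
        finite_set [set p : tau * nat | V p.1 p.2 `&` N !=set0]].
  move=> n; apply: locally_finite_open_refinement.
    by move=> t; exact: ball_open.
  move=> y; have [|t yt] := dP y (del n); first by rewrite mulr_gt0// expR_gt0.
  by exists t; rewrite -ball_normE /= distrC.
pose O (i : tau * (nat * int)) : set X :=
  [set x | U i.2.2 x /\ psi i.2.2 x `&` V i.2.2 i.1 i.2.1 !=set0].
have [| | | |f fc fP] := @PF_normal_convex_selection R tau
  (tau * (nat * int)) X Y O (fun i => d i.1) PFX.
- apply: card_le_trans (infinite_prod_nat_card_le tau inftau).
  apply/card_setT_leP; exists (fun i => (i.1, pickle i.2)) => //.
  by move=> [t p] [u q] /= [-> /(pcan_inj pickleK) ->].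
- move=> [t [k n]]; have [lscn _ _] := psiP n; have [Vo _ _ _] := VP n.
  exact: lscn.
- move=> x; have Ux : U (Num.floor (s x)) x.
    rewrite /U /= ger0_norm ?subr_ge0 ?floor_le//.
    by rewrite ltrBlDl; have := floorD1_gt (s x); rewrite intrD addrC.
  have [_ /(_ x Ux)[[y psiy] _] _] := psiP (Num.floor (s x)).
  have [_ _ /(_ y)[t [k Vy]] _] := VP (Num.floor (s x)).
  by exists (t, (k, Num.floor (s x))); split=> //; exists y.
- move=> x; pose m := Num.floor (s x).
  pose S n := (fun p : tau * nat => (p.1, (p.2, n))) @`
    [set p | O (p.1, (p.2, n)) x].
  have finS n : finite_set (S n).
    apply: finite_image; have [Ux|nUx] := pselect (U n x); last first.
      by apply: (sub_finite_set _ (finite_set0 _)) => p [].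
    have [_ /(_ x Ux)[_ cpt] _] := psiP n; have [_ _ _ locV] := VP n.
    apply: sub_finite_set (compact_locally_finite _ _ _ _ locV cpt).
    by move=> p [_].
  apply: (@sub_finite_set _ _ (S m `|` S (m + 1))); last by rewrite finite_setU.
  move=> [t [k n]] Ox.
  have [<-|<-] : n = m \/ n = m + 1;
    [|by left; exists (t, k)|by right; exists (t, k)].
  have [+ _] := Ox; rewrite /U /= ltr_norml => /andP[n1 n2].
  have m1 := floor_le (s x); have m2 := floorD1_gt (s x).
  have mn : (m < n + 1)%R by rewrite -(ltr_int R) intrD; rewrite /m; lra.
  have nm : (n < m + 1 + 1)%R.
    by rewrite -(ltr_int R) !intrD; move: m2; rewrite intrD /m; lra.
  lia.
exists f => // x C cC Cy; apply: fP => // -[t [k n]] [Ux [v [psiv Vv]]] /=.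
have [_ _ /(_ x Ux v psiv) clv] := psiP n.
have [Vo Vsub _ _] := VP n.
have [w [[phiw gw] Vw]] : (phi x `&` ball (g x) (eps n)) `&` V n t k !=set0.
  by apply: clv; apply: open_nbhs_nbhs; split.
have [_ [epsr delr]] := rU n x Ux.
apply: (Cy _ w) => //.
  by apply: lt_trans epsr; move: gw; rewrite -ball_normE.
by apply: lt_trans delr; have := Vsub _ _ _ Vw; rewrite -ball_normE /= distrC.
Qed.

(** * Selections *)

(** With [k = (1 - alpha) / 4], paraconvexity bounds the new distance by
    [(alpha * (1 + k) + k) * r x], and [alpha * (1 + k) + k] is at most
    [alpha + 2 * k = (1 + alpha) / 2] since [alpha] is below one. *)
Lemma DMP_selection_step (R : realType) (tau : Type) (X : topologicalType)
    (Y : normedModType R) (alpha : R) (phi : X -> set Y) (g : X -> Y)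
    (r : X -> R) :
  infinite_set [set: tau] -> weight_le Y tau -> PF_normal tau X ->
  0 <= alpha < 1 -> (forall x, closed_paraconvex alpha (phi x)) -> DMP phi ->
  continuous g -> continuous r -> (forall x, 0 < r x) ->
  (forall x, dist_set (g x) (phi x) < r x) ->
  exists2 f : X -> Y, continuous f & forall x,
    dist_set (f x) (phi x) < (1 + alpha) / 2 * r x /\ `|g x - f x| < 2 * r x.
Proof.
move=> inftau wY PFX /andP[alpha0 alpha1] phiP dmp gc rc r0 gr.
pose k := (1 - alpha) / 4; have k0 : 0 < k by rewrite /k; lra.
have [||f fc fP] := DMP_approximation R tau X Y phi g r (1 + k) k inftau wY PFX
  dmp gc rc r0 gr; [lra|exact: k0|].
exists f => // x; have [[phi0 _] para] := phiP x; have rx := r0 x.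
have [||d1 d2] := @paraconvex_hull_neighbourhood R Y alpha ((1 + k) * r x)
  (k * r x) (phi x) (g x) (f x) phi0 para.
- by have := gr x; nra.
- apply: fP; first exact: convex_hull_neighbourhood.
  move=> y v phiv gv vy; exists v; last by rewrite distrC.
  by apply: sub_convex_hull; split=> //; rewrite -ball_normE.
have kE : 4 * k = 1 - alpha by rewrite /k; lra.
have kr : 0 < k * r x by rewrite mulr_gt0.
have akr : alpha * (k * r x) <= k * r x by rewrite ler_piMl// ltW.
have ar : alpha * r x = r x - 4 * (k * r x) by rewrite mulrA kE; ring.
have ar0 : 0 <= alpha * r x by rewrite mulr_ge0// ltW.
by split; [apply: lt_le_trans d1 _|apply: lt_le_trans d2 _]; lra.
Qed.

(** The displacements in the iteration are dominated by a geometric series of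
    ratio [b = (1 + alpha) / 2], whose sum is [2 * r x / (1 - b) = K x]. The
    tails are controlled by [b ^+ n * K x]; as [K] is continuous, hence locally
    bounded, convergence is locally uniform and the limit is continuous. *)
Theorem DMP_selection (R : realType) (tau : Type) (X : topologicalType)
    (Y : completeNormedModType R) (alpha : R) (phi : X -> set Y) (g : X -> Y)
    (r : X -> R) :
  infinite_set [set: tau] -> weight_le Y tau -> PF_normal tau X ->
  0 <= alpha < 1 -> (forall x, closed_paraconvex alpha (phi x)) -> DMP phi ->
  continuous g -> continuous r -> (forall x, 0 < r x) ->
  (forall x, dist_set (g x) (phi x) < r x) ->
  exists2 f : X -> Y, continuous_selection f phi &
    forall x, `|g x - f x| <= 4 / (1 - alpha) * r x.
Proof.
move=> inftau wY PFX alpha01 phiP dmp gc rc r0 gr.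
have /andP[alpha0 alpha1] := alpha01.
pose b := (1 + alpha) / 2.
have b0 : 0 < b by rewrite /b; lra.
have b1 : b < 1 by rewrite /b; lra.
pose good n (h : X -> Y) :=
  continuous h /\ forall x, dist_set (h x) (phi x) < b ^+ n * r x.
have /choice[F FP] : forall p : nat * (X -> Y), exists h : X -> Y,
    good p.1 p.2 -> good p.1.+1 h /\
      forall x, `|p.2 x - h x| < 2 * (b ^+ p.1 * r x).
  move=> [n h]; have [[hc hr]|ngood] := pselect (good n h); last by exists h.
  have [| |f fc fP] := DMP_selection_step R tau X Y alpha phi h
    (fun x => b ^+ n * r x) inftau wY PFX alpha01 phiP dmp hc _ _ hr.
  - by move=> x; apply: cvgM; [exact: cvg_cst|exact: rc].
  - by move=> x; rewrite mulr_gt0// exprn_gt0.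
  exists f => _; split=> [|x]; last by have [] := fP x.
  by split=> // x; rewrite exprS -mulrA; have [] := fP x.
pose G := fix G n := if n is m.+1 then F (m, G m) else g.
have Ggood n : good n (G n).
  elim: n => [|n IHn]; first by split=> // x; rewrite expr0 mul1r.
  by have [] := FP (n, G n) IHn.
have Gstep n x : `|G n x - G n.+1 x| < 2 * (b ^+ n * r x).
  by have [_] := FP (n, G n) (Ggood n); exact.
pose K x := 4 / (1 - alpha) * r x.
have K0 x : 0 < K x by rewrite mulr_gt0// divr_gt0// subr_gt0.
have KE x : 2 * r x = (1 - b) * K x.
  rewrite /K /b; field; lra.
have Gdist n k x : `|G n x - G (n + k)%N x| <= (b ^+ n - b ^+ (n + k)) * K x.
  elim: k => [|k IHk]; first by rewrite addn0 !subrr normr0 mul0r.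
  have := ler_distD (G (n + k)%N x) (G n x) (G (n + k.+1)%N x).
  have := Gstep (n + k)%N x; rewrite -addnS.
  have : 2 * (b ^+ (n + k) * r x) = (b ^+ (n + k) - b ^+ (n + k.+1)) * K x.
    by rewrite mulrCA KE addnS exprS; ring.
  lra.
have Gdist_le m n x : (n <= m)%N -> `|G n x - G m x| <= b ^+ n * K x.
  move=> nm; rewrite -(subnKC nm); apply: le_trans (Gdist _ _ _) _.
  by rewrite ler_pM2r// gerBl exprn_ge0// ltW.
have small x (e : R) : 0 < e -> exists n, b ^+ n * (K x + 1) < e.
  move=> e0; have K1 : 0 < K x + 1 by have := K0 x; lra.
  have b01 : 0 < b < 1 by rewrite b0.
  have [n bn] := expr_lt_eps R b _ b01 (divr_gt0 e0 K1).
  by exists n; rewrite -ltr_pdivlMr.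
have Gcvg x : cvgn (fun n => G n x).
  apply/cauchy_cvgP/cauchy_exP => e e0; have [n ne] := small x e e0.
  exists (G n x); exists n => // m /= nm; rewrite -ball_normE /=.
  apply: le_lt_trans (Gdist_le _ _ _ nm) _; apply: le_lt_trans ne.
  by rewrite ler_pM2l ?exprn_gt0// lerDl.
pose f x := limn (fun n => G n x).
have fdist n x : `|G n x - f x| <= b ^+ n * K x.
  apply/ler_addgt0Pr => e e0.
  have /cvgrPdist_lt/(_ _ e0)[m _ /(_ (maxn m n)) mP] := Gcvg x.
  have := mP (leq_maxl _ _); rewrite distrC => fm.
  have := Gdist_le (maxn m n) n x (leq_maxr _ _).
  have := ler_distD (G (maxn m n) x) (G n x) (f x).
  by rewrite -/(f x) in fm; lra.
exists f; last by move=> x; have := fdist 0 x; rewrite expr0 mul1r.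
split=> x.
  apply/cvgrPdist_lt => e e0.
  have [|n ne] := small x (e / 3); first by rewrite divr_gt0.
  have Kc : {for x, continuous K} by apply: cvgM; [exact: cvg_cst|exact: rc].
  have /cvgrPdist_lt/(_ _ ltr01) nearK := Kc.
  have [/(_ x)/cvgrPdist_lt/(_ (e / 3)) nearG _] := Ggood n.
  near=> z.
  have Gz : `|G n x - G n z| < e / 3.
    by near: z; apply: nearG; rewrite divr_gt0.
  have Kz : K z < K x + 1.
    have : `|K x - K z| < 1 by near: z.
    by rewrite ltr_norml => /andP[]; lra.
  have bK : b ^+ n * K z < e / 3.
    by apply: lt_trans ne; rewrite ltr_pM2l ?exprn_gt0.
  have bK' : b ^+ n * K x < e / 3.
    by apply: lt_trans ne; rewrite ltr_pM2l ?exprn_gt0// ltrDl.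
  have := ler_distD (G n x) (f x) (f z); rewrite (distrC (f x) (G n x)).
  have := ler_distD (G n z) (G n x) (f z).
  by have := fdist n x; have := fdist n z; lra.
have [[phi0 phicl] _] := phiP x.
apply: closed_dist_set0 => //; apply/ler_addgt0Pr => e e0; rewrite add0r.
have [|n ne] := small x (e / 2); first by rewrite divr_gt0.
have [_ /(_ x) dn] := Ggood n.
have := dist_set_triangle (f x) (G n x) (phi x) phi0; rewrite distrC.
have rK : r x <= K x + 1.
  have : 1 <= 4 / (1 - alpha) by rewrite ler_pdivlMr ?subr_gt0//; lra.
  by move=> /(ler_peMl (ltW (r0 x))); rewrite -/(K x); lra.
have bn : 0 < b ^+ n by rewrite exprn_gt0.
have := fdist n x.
have : b ^+ n * r x <= b ^+ n * (K x + 1) by rewrite ler_pM2l.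
have : b ^+ n * K x <= b ^+ n * (K x + 1) by rewrite ler_pM2l// lerDl.
lra.
Unshelve. all: by end_near. Qed.

(** The convex sets to select from are the rays above the distance from [0] to
    [phi x]. The annulus [A n] of points of norm within one of [n] is given
    the value [n + 1]: if [psi x] meets it, then [phi x] has a point of norm
    below [n + 1]. Annuli, unlike balls, form a locally finite family. *)
Lemma compact_multi_selection_bound (R : realType) (tau : Type)
    (X : topologicalType) (Y : normedModType R) (phi psi : X -> set Y) :
  infinite_set [set: tau] -> PF_normal tau X -> lsc psi ->
  (forall x, nonempty_compact (psi x)) -> multi_selection psi phi ->
  exists2 r : X -> R, continuous r & forall x, dist_set 0 (phi x) < r x.
Proof.
move=> inftau PFX psi_lsc psi_cpt psi_sub.
pose A (n : nat) : set Y := [set y | `| `|y| - n%:R| < 1].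
have Aopen n : open (A n).
  have Ac : continuous (fun y : Y => `| `|y| - n%:R|).
    move=> y; apply: cvg_norm; apply: cvgB; last exact: cvg_cst.
    exact: norm_continuous.
  apply: (open_comp (D := [set t : R | t < 1])) => [y _|]; first exact: Ac.
  exact: open_lt.
pose O n : set X := [set x | psi x `&` A n !=set0].
have [| | | |r rc rP] := @PF_normal_convex_selection R tau nat X R^o
  O (fun n => n%:R + 1) PFX.
- exact/infiniteP.
- by move=> n; exact: psi_lsc.
- move=> x; have [[[y psiy] _] _] := psi_cpt x.
  have [n n1 n2] : exists2 n : nat, n%:R <= `|y| & `|y| < n%:R + 1.
    exists (Num.truncn `|y|); first by rewrite truncn_le.
    by rewrite natr1 truncnS_gt.
  by exists n, y; split=> //; rewrite /A /= ger0_norm ?subr_ge0// ltrBlDl.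
- move=> x; have [_ cpt] := psi_cpt x.
  apply: compact_locally_finite cpt => y.
  exists (ball y 1); first exact: nbhsx_ballx.
  have [m ym] : exists m : nat, `|y| + 2 < m%:R.
    by exists (Num.bound (`|y| + 2)); apply: archi_boundP; rewrite addr_ge0.
  apply: (sub_finite_set _ (finite_II m)) => n [v [+ +]].
  rewrite -ball_normE /A /= => nv yv.
  rewrite -(ltr_nat R); apply: lt_trans ym.
  have := ler_distD y v 0; rewrite !subr0 distrC.
  by move: nv; rewrite ltr_norml => /andP[]; lra.
exists r => // x.
apply: (rP x [set t | dist_set 0 (phi x) < t]).
  apply/convex_setP => s t a b /= ps pt a0 b0 ab; rewrite -ltrN2 opprD.
  by rewrite -!scalerN; apply: convex_combination_lt; rewrite ?ltrN2.
move=> n [v [psiv nv]] /=.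
apply: le_lt_trans (dist_set_le 0 v _ (psi_sub x v psiv)) _.
by rewrite sub0r normrN; move: nv; rewrite /A /= ltr_norml => /andP[]; lra.
Qed.

Theorem theorem3p1 (R : realType) :
  (forall (tau : Type) (Y : completeNormedModType R) (alpha : R),
     infinite_set [set: tau] -> weight_le Y tau -> 0 <= alpha < 1 ->
     forall (X : topologicalType) (phi : X -> set Y),
       PF_normal tau X ->
       (forall x, closed_paraconvex alpha (phi x)) ->
       DMP phi ->
       exists f : X -> Y, continuous_selection f phi)
  /\
  (forall alpha : R, 0 <= alpha < 1 ->
     exists2 delta : R, 0 < delta &
       forall (tau : Type) (Y : completeNormedModType R) (X : topologicalType)
         (phi : X -> set Y) (g : X -> Y) (r : R),
         infinite_set [set: tau] -> weight_le Y tau -> PF_normal tau X ->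
         (forall x, closed_paraconvex alpha (phi x)) ->
         DMP phi ->
         0 < r -> continuous g -> eps_selection r g phi ->
         exists2 f : X -> Y, continuous_selection f phi &
           forall x, `|g x - f x| < delta * r).
Proof.
split=> [tau Y alpha inftau wY alpha01 X phi PFX phiP dmp|alpha alpha01].
  have [[psi [psi_lsc psi_cpt psi_sub]] _] := dmp.
  have [r rc rP] :=
    compact_multi_selection_bound R tau X Y phi psi inftau PFX
      psi_lsc psi_cpt psi_sub.
  have [| |f fsel _] := DMP_selection R tau X Y alpha phi (cst 0) r inftau wY
    PFX alpha01 phiP dmp _ rc _ rP.
  - by move=> x; exact: cvg_cst.
  - by move=> x; apply: le_lt_trans (rP x); exact: dist_set_ge0.
  by exists f.
have /andP[_ alpha1] := alpha01.
have delta0 : 0 < 4 / (1 - alpha) by rewrite divr_gt0// subr_gt0.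
exists (4 / (1 - alpha) + 1); first by rewrite addr_gt0.
move=> tau Y X phi g r inftau wY PFX phiP dmp r0 gc gr.
have [| |f fsel fg] := DMP_selection R tau X Y alpha phi g (cst r) inftau wY PFX
  alpha01 phiP dmp gc _ _ gr.
- by move=> x; exact: cvg_cst.
- by [].
exists f => // x; apply: le_lt_trans (fg x) _.
by rewrite ltr_pM2r// ltrDl.
Qed.
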